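(* Let $\boldsymbol\varepsilon$ be an $m$-dimensional random vector with $\mathrm E\,\boldsymbol\varepsilon=\mathbf 0$. Let $\mathbf Q=(\mathbf u\,|\,\boldsymbol\Gamma_{\mathbf u})$ and $\widetilde{\mathbf Q}=(\mathbf u\,|\,-\boldsymbol\Gamma_{\mathbf u})$. Then $H_0(\mathbf u)$ holds, i.e. $\mathcal L(\boldsymbol\varepsilon)=\mathcal L(\mathbf R_{\mathbf u}\boldsymbol\varepsilon)$, if and only if $\mathcal L(\mathbf Q^\top\boldsymbol\varepsilon)=\mathcal L(\widetilde{\mathbf Q}^\top\boldsymbol\varepsilon)$.
   Context: $m\ge2$ is an integer, $\mathbf u\in\mathbb R^m$ is a fixed vector with $\|\mathbf u\|=1$, and $\boldsymbol\Gamma_{\mathbf u}$ is any $m\times(m-1)$ matrix such that $(\mathbf u\,|\,\boldsymbol\Gamma_{\mathbf u})$ is orthogonal. $\mathbf R_{\mathbf u}=2\mathbf u\mathbf u^\top-\mathbf I$ is the orthogonal reflection matrix, and $\mathcal L(\boldsymbol Z)$ denotes the distribution of $\boldsymbol Z$. *)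

(* Defs.v *)
From HB Require Import structures.
From mathcomp Require Import all_boot all_order all_algebra.
From mathcomp Require Import all_classical all_reals all_analysis giry.
Import Order.TTheory GRing.Theory Num.Theory.
Import numFieldNormedType.Exports.

Set Implicit Arguments.
Unset Strict Implicit.
Unset Printing Implicit Defensive.

Local Open Scope classical_set_scope.
Local Open Scope ring_scope.

(* The column vectors with their Borel sigma-algebra; the carrier unfolds to
   'cV[R]_m, whose topology is the usual (entrywise) one. *)
Notation borel_cV R m := (g_sigma_algebraType (@open 'cV[R]_m)).

(* The library norm `|u| on matrices is the sup norm, hence this definition. *)
Definition euclidean_norm (R : realType) (m : nat) (u : 'cV[R]_m) : R :=
  Num.sqrt (\sum_(i < m) u i 0 ^+ 2).

(* The type is rectangular because the width 1 + m.-1 of (u | Gamma) is not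
   convertible to m; the two equations together force m = n. *)
Definition orthogonal_mx (R : realType) (m n : nat) (Q : 'M[R]_(m, n)) : Prop :=
  Q^T *m Q = 1%:M /\ Q *m Q^T = 1%:M.

Definition reflection_mx (R : realType) (m : nat) (u : 'cV[R]_m) : 'M[R]_m :=
  2 *: (u *m u^T) - 1%:M.

Lemma mulmx_continuous (R : realType) (m n : nat) (A : 'M[R]_(m, n)) :
  continuous (mulmx A : 'cV[R]_n -> 'cV[R]_m).
Proof.
move=> x B /= [P xP PB].
have cA i j : continuous (fun y : 'cV[R]_n => (A *m y) i j).
  have -> : (fun y : 'cV[R]_n => (A *m y) i j) =
      (fun y => \sum_(k < n) A i k * y k j) by apply/funext => y; rewrite mxE.
  elim: (index_enum _) => [|k r IHr].
    have -> : (fun y : 'cV[R]_n => \sum_(k <- [::]) A i k * y k j) = cst 0.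
      by apply/funext => y; rewrite big_nil.
    exact: cst_continuous.
  have -> : (fun y : 'cV[R]_n => \sum_(l <- k :: r) A i l * y l j) =
      (fun y => A i k * y k j + \sum_(l <- r) A i l * y l j).
    by apply/funext => y; rewrite big_cons.
  move=> y; apply: (@cvgD _ R^o _ _ (nbhs_filter y)); last exact: IHr.
  exact: cvg_comp (@coord_continuous R n 1 k j y)
    (@mulrl_continuous R (A i k) (y k j)).
have nP : \forall y \near x, forall k : 'I_m * 'I_1,
    P k.1 k.2 ((A *m y) k.1 k.2).
  apply: (@filter_forall _ _
    (fun k : 'I_m * 'I_1 => [set y | P k.1 k.2 ((A *m y) k.1 k.2)])
    _ (nbhs_filter x)).
  by move=> [i j]; exact: cA (xP i j).
by apply: filterS nP => y yP; apply: PB => i j; exact: (yP (i, j)).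
Qed.

Lemma measurable_mulmx (R : realType) (m n : nat) (A : 'M[R]_(m, n)) :
  measurable_fun [set: borel_cV R n] (mulmx A : borel_cV R n -> borel_cV R m).
Proof.
apply: (@measurability _ _ (borel_cV R n) (borel_cV R m) _ _ (@open 'cV[R]_m)) => //.
move=> _ [B oB <-]; rewrite setTI; apply: sub_sigma_algebra.
by move/continuousP: (@mulmx_continuous R m n A); exact.
Qed.

Definition mulmx_RV d (T : measurableType d) (R : realType) (m n : nat)
    (A : 'M[R]_(m, n)) (X : {mfun T >-> borel_cV R n}) : T -> borel_cV R m :=
  fun w => A *m X w.

Section mulmx_RV_measurable.
Context d (T : measurableType d) (R : realType) (m n : nat).
Variables (A : 'M[R]_(m, n)) (X : {mfun T >-> borel_cV R n}).

Let mulmx_RV_measurable : measurable_fun [set: T] (mulmx_RV A X).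
Proof. exact: measurableT_comp (measurable_mulmx A) _. Qed.

HB.instance Definition _ :=
  isMeasurableFun.Build _ _ _ _ (mulmx_RV A X) mulmx_RV_measurable.
End mulmx_RV_measurable.

Definition has_mean d (T : measurableType d) (R : realType) (P : probability T R)
    (m : nat) (X : {RV P >-> borel_cV R m}) (mu : 'cV[R]_m) : Prop :=
  forall i : 'I_m, P.-integrable [set: T] (fun w => (X w i ord0)%:E) /\
    ('E_P[fun w => X w i ord0])%E = (mu i ord0)%:E.
Arguments has_mean {d T R} P {m} X mu.

(* Laws are compared with measure_eq, i.e. on measurable sets only: the library
   measures are total on sets, with meaningless values on non-measurable ones. *)
Definition eq_law d d' (T : measurableType d) (T' : measurableType d')
    (R : realType) (P : probability T R) (X Y : {RV P >-> T'}) : Prop :=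
  measure_eq (distribution P X) (distribution P Y).
Arguments eq_law {d d' T T' R} P X Y.

Definition H0 d (T : measurableType d) (R : realType) (P : probability T R)
    (m : nat) (eps : {RV P >-> borel_cV R m}) (u : 'cV[R]_m) : Prop :=
  eq_law P eps (mulmx_RV (reflection_mx u) eps).
Arguments H0 {d T R} P {m} eps u.

(* Main.v *)
(* Both sides are related by Q (Q~^T eps) = R_u eps and Q (Q^T eps) = eps:
   equality in law is preserved by linear maps, so one applies Q^T to pass from
   the left to the right and Q to come back. *)

Require Import Defs.
From HB Require Import structures.
From mathcomp Require Import all_boot all_order all_algebra.
From mathcomp Require Import all_classical all_reals all_analysis.
Import Order.TTheory GRing.Theory Num.Theory.
Import numFieldNormedType.Exports.

Set Implicit Arguments.
Unset Strict Implicit.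
Unset Printing Implicit Defensive.

Local Open Scope classical_set_scope.
Local Open Scope ring_scope.

Lemma mulmx_RVA d (T : measurableType d) (R : realType) (m n p : nat)
    (A : 'M[R]_(m, n)) (B : 'M[R]_(n, p)) (X : {mfun T >-> borel_cV R p})
    (w : T) :
  mulmx_RV A (mulmx_RV B X) w = mulmx_RV (A *m B) X w.
Proof. exact: mulmxA. Qed.

(** The preimage of a Borel set under [mulmx A] is Borel, so the hypothesis can be tested on it. *)
Lemma eq_law_mulmx d (T : measurableType d) (R : realType)
    (P : probability T R) (m n : nat) (A : 'M[R]_(m, n))
    (X Y : {RV P >-> borel_cV R n}) :
  eq_law P X Y -> eq_law P (mulmx_RV A X) (mulmx_RV A Y).
Proof.
move=> XY B mB; apply: (XY (mulmx A @^-1` B)).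
by rewrite -[X in measurable X]setTI; exact: measurable_mulmx.
Qed.

(** Random variables bundle a measurability proof, so pointwise equality does not allow direct
    rewriting; the law, however, sees only the underlying function, through preimages. *)
Lemma eq_law_ext d d' (T : measurableType d) (T' : measurableType d')
    (R : realType) (P : probability T R) (X X' Y Y' : {RV P >-> T'}) :
  X =1 X' -> Y =1 Y' -> eq_law P X Y -> eq_law P X' Y'.
Proof.
move=> /funext XX' /funext YY' XY B mB; have := XY B mB.
change (P (X @^-1` B) = P (Y @^-1` B) -> P (X' @^-1` B) = P (Y' @^-1` B)).
by rewrite XX' YY'.
Qed.

(** The hypothesis reads [u *m u^T + Gamma *m Gamma^T = 1%:M]; substituted for the identity in
    [reflection_mx u], it leaves [u *m u^T - Gamma *m Gamma^T], the block product on the left. *)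
Lemma mul_orthogonal_reflection (R : realType) (m n : nat) (u : 'cV[R]_m)
    (Gamma : 'M[R]_(m, n)) :
  row_mx u Gamma *m (row_mx u Gamma)^T = 1%:M ->
  row_mx u Gamma *m (row_mx u (- Gamma))^T = reflection_mx u.
Proof.
rewrite /reflection_mx !tr_row_mx !mul_row_col linearN mulmxN => <-.
by rewrite scaler_nat mulr2n opprD addrA addrK.
Qed.

Theorem lemma1 (R : realType) (m : nat) (hm : (2 <= m)%N)
    (u : 'cV[R]_m) (hu : euclidean_norm u = 1)
    (Gamma : 'M[R]_(m, m.-1)) (hGamma : orthogonal_mx (row_mx u Gamma))
    (d : measure_display) (T : measurableType d) (P : probability T R)
    (eps : {RV P >-> borel_cV R m}) (heps : has_mean P eps 0) :
  let Q := row_mx u Gamma in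
  let Qtilde := row_mx u (- Gamma) in
  H0 P eps u <-> eq_law P (mulmx_RV Q^T eps) (mulmx_RV Qtilde^T eps).
Proof.
move=> Q Qtilde; have [QTQ QQT] := hGamma.
have QQtilde : Q *m Qtilde^T = reflection_mx u by exact: mul_orthogonal_reflection.
split=> /eq_law_mulmx.
  move=> /(_ _ Q^T); apply: eq_law_ext => // w.
  (* Here [Q^T *m reflection_mx u = (Q^T *m Q) *m Qtilde^T = Qtilde^T]. *)
  by rewrite /= mulmx_RVA -QQtilde mulmxA QTQ mul1mx.
move=> /(_ _ Q); apply: eq_law_ext => w /=.
  by rewrite mulmx_RVA QQT; exact: mul1mx.
by rewrite mulmx_RVA QQtilde.
Qed.
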